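(* Generically, the evolutoid $\mathcal{E}_1$ of $S$ is regular if and only if the origin is not a ridge point of $S$ with respect to the vector $\partial_v$.
   Context: $S\subset\mathbb{R}^3$ is a regular surface which is locally the image of the Monge form parametrization $\phi(u,v)=(u,v,f(u,v))$ near $(0,0)$, where $f$ has Taylor expansion at the origin $$f(u,v)=\tfrac12\big(\kappa_1(0)u^2+\kappa_2(0)v^2\big)+\sum_{s\ge 3}\ \sum_{i+j=s}\frac{a_{ij}}{i!\,j!}u^iv^j ,$$ and $\kappa_1(0),\kappa_2(0)$ are the principal curvatures at the origin. The origin is neither a parabolic nor an umbilic point of $S$, and $\kappa_1(0)>\kappa_2(0)$. Let $\alpha\in(0,\pi/2)$ be fixed. The evolutoid $\mathcal{E}_1$ comes from the envelope of the lines through the points of $S$ with direction $\cos(\alpha)\,\phi_u/\|\phi_u\|+\sin(\alpha)N$ ($N$ the unit normal), and is given by $$\mathcal{E}_1=\phi+r\Big(\frac{\cos\alpha}{\sqrt E}\,\phi_u+\sin(\alpha)N\Big),\qquad r=-\frac{2\sqrt E\,G}{\cos(\alpha)G_u-2\sin(\alpha)\sqrt E\,G\,\kappa_2},$$ with $E=\langle\phi_u,\phi_u\rangle$, $G=\langle\phi_v,\phi_v\rangle$ and $\kappa_2$ the second principal curvature. In the Monge form its local parametrization is $\mathcal{E}_1(u,v)=(h_1,h_2,h_3)$ with, writing $\kappa_i=\kappa_i(0)$, $$h_1=\frac{\cot\alpha}{\kappa_2}+\frac{\kappa_2(\kappa_2-\kappa_1)-a_{12}\cot\alpha}{\kappa_2^2}\,u-\frac{a_{03}\cot\alpha}{\kappa_2^2}\,v+O(2),$$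 $$h_2=-\frac{a_{21}}{2\kappa_2}\,u^2+\frac{a_{03}}{2\kappa_2}\,v^2+O(3),$$ $$h_3=\frac1{\kappa_2}+\frac{-a_{12}+\kappa_1\kappa_2\cot\alpha}{\kappa_2^2}\,u-\frac{a_{03}}{\kappa_2^2}\,v+O(2).$$ Regularity of $\mathcal{E}_1$ is understood at the point $p=\mathcal{E}_1(0,0)$ corresponding to the origin: the derivative of the parametrization has rank $2$ at $(0,0)$. A ridge point of $S$ is an $A_3$-singularity of some distance squared function on $S$ (a function germ has an $A_k$-singularity if, up to smooth changes of coordinates in source and target, it is $\pm x_1^{k+1}\pm x_2^2$); the closure of the set of ridge points is the ridge of $S$. In the Monge form, the origin being a ridge point with respect to $\partial_v$ (the principal direction associated with $\kappa_2$) is taken to mean $a_{03}=0$. *)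

(* Defs.v *)
From mathcomp Require Import all_boot all_order all_algebra.
From mathcomp Require Import all_classical all_reals all_analysis.

Set Implicit Arguments.
Unset Strict Implicit.
Unset Printing Implicit Defensive.
Import Order.TTheory GRing.Theory Num.Theory.
Import numFieldNormedType.Exports.

Local Open Scope classical_set_scope.
Local Open Scope ring_scope.

(* Partial derivatives on the (u,v)-plane 'rV[R]_2: index 0 is u, index 1 is v. *)
Definition pd (R : realType) (V : normedModType R) (i : 'I_2)
    (g : 'rV[R]_2 -> V) : 'rV[R]_2 -> V :=
  fun x => 'D_(delta_mx 0 i : 'rV[R]_2) g x.

(* C^oo on a neighbourhood of p: all iterated partial derivatives are
   differentiable there. *)
Definition smooth_near (R : realType) (V : normedModType R)
    (g : 'rV[R]_2 -> V) (p : 'rV[R]_2) : Prop :=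
  \forall x \near p, forall s : seq 'I_2,
    differentiable (foldr (@pd R V) g s) x.

(* Derivative of rank 2 at p.  Differentiability is required explicitly because
   'J g p is an arbitrary matrix when g is not differentiable at p. *)
Definition regular_at (R : realType) (g : 'rV[R]_2 -> 'rV[R]_3)
    (p : 'rV[R]_2) : Prop :=
  differentiable g p /\ \rank ('J g p) = 2%N.

Section SurfacesInR3.
Context {R : realType}.

Definition vec3 (a b c : R) : 'rV[R]_3 := \row_j [:: a; b; c]`_j.

Definition dot (a b : 'rV[R]_3) : R := \sum_j a 0 j * b 0 j.

(* The norm `|a| of the library on 'rV[R]_3 is the sup norm. *)
Definition enorm (a : 'rV[R]_3) : R := Num.sqrt (dot a a).

Definition cross (a b : 'rV[R]_3) : 'rV[R]_3 :=
  let x := a 0 in let y := b 0 in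
  vec3 (x 1 * y 2 - x 2 * y 1)
       (x 2 * y 0 - x 0 * y 2)
       (x 0 * y 1 - x 1 * y 0).

Variable phi : 'rV[R]_2 -> 'rV[R]_3.

Definition unit_normal (x : 'rV[R]_2) : 'rV[R]_3 :=
  let n := cross (pd 0 phi x) (pd 1 phi x) in (enorm n)^-1 *: n.

Definition coefE (x : 'rV[R]_2) : R := dot (pd 0 phi x) (pd 0 phi x).
Definition coefF (x : 'rV[R]_2) : R := dot (pd 0 phi x) (pd 1 phi x).
Definition coefG (x : 'rV[R]_2) : R := dot (pd 1 phi x) (pd 1 phi x).

Definition coefL (x : 'rV[R]_2) : R := dot (pd 0 (pd 0 phi) x) (unit_normal x).
Definition coefM (x : 'rV[R]_2) : R := dot (pd 0 (pd 1 phi) x) (unit_normal x).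
Definition coefN (x : 'rV[R]_2) : R := dot (pd 1 (pd 1 phi) x) (unit_normal x).

Definition gauss_curvature (x : 'rV[R]_2) : R :=
  (coefL x * coefN x - coefM x ^+ 2) / (coefE x * coefG x - coefF x ^+ 2).

Definition mean_curvature (x : 'rV[R]_2) : R :=
  (coefE x * coefN x - 2 * coefF x * coefM x + coefG x * coefL x)
  / (2 * (coefE x * coefG x - coefF x ^+ 2)).

(* The second principal curvature is the smaller one (kappa_1 > kappa_2). *)
Definition kappa2 (x : 'rV[R]_2) : R :=
  mean_curvature x - Num.sqrt (mean_curvature x ^+ 2 - gauss_curvature x).

Definition evolutoid_radius (alpha : R) (x : 'rV[R]_2) : R :=
  - (2 * Num.sqrt (coefE x) * coefG x)
  / (cos alpha * pd 0 coefG x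
     - 2 * sin alpha * Num.sqrt (coefE x) * coefG x * kappa2 x).

Definition evolutoid1 (alpha : R) (x : 'rV[R]_2) : 'rV[R]_3 :=
  phi x + evolutoid_radius alpha x *:
    ((cos alpha / Num.sqrt (coefE x)) *: pd 0 phi x
     + sin alpha *: unit_normal x).

End SurfacesInR3.

Section MongeForm.
Context {R : realType}.
Implicit Type f : 'rV[R]_2 -> R.

Definition monge f : 'rV[R]_2 -> 'rV[R]_3 :=
  fun x => vec3 (x 0 0) (x 0 1) (f x).

(* a_ij, the coefficient of u^i v^j / (i! j!) in the Taylor expansion of f at 0. *)
Definition taylor_coef f (i j : nat) : R :=
  iter i (pd 0) (iter j (pd 1) f) 0.

(* The 2-jet at 0 of f is (k1 u^2 + k2 v^2) / 2, so that k1 and k2 are the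
   principal curvatures at the origin in the directions of u and v. *)
Definition monge_form f (k1 k2 : R) : Prop :=
  [/\ smooth_near f 0, f 0 = 0, (forall i, pd i f 0 = 0) &
      forall i j : 'I_2, pd i (pd j f) 0 =
        if i == j then (if i == 0 then k1 else k2) else 0].

(* The origin is neither parabolic nor umbilic, and kappa_1(0) > kappa_2(0). *)
Definition admissible_curvatures : set (R * R) :=
  [set k | k.2 < k.1 /\ k.1 * k.2 != 0].

Definition ridge_origin_dv f : Prop := taylor_coef f 0 3 = 0.

(* P holds for generic f: it holds as soon as the 2-jet of f at the origin, i.e.
   the pair of principal curvatures, lies in a suitable open dense set.
   The genericity condition must not involve jets of higher order: the set of f
   with a03 != 0 is itself open and dense, so excluding ridges altogether would
   count as generic and make one implication of an equivalence with a03 != 0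
   vacuous.  An open dense set of 2-jets pulls back to an open dense set both of
   all Monge forms and of those for which the origin is a ridge point. *)
Definition generically (P : ('rV[R]_2 -> R) -> Prop) : Prop :=
  exists W : set (R * R),
    [/\ open W, admissible_curvatures `<=` closure W &
        forall f (k1 k2 : R), monge_form f k1 k2 ->
          admissible_curvatures (k1, k2) -> W (k1, k2) -> P f].

End MongeForm.

(* Main.v *)
Require Import Defs.
From mathcomp Require Import all_boot all_order all_algebra.
From mathcomp Require Import all_classical all_reals all_analysis.
From mathcomp Require Import ring.
Set Implicit Arguments.
Unset Strict Implicit.
Unset Printing Implicit Defensive.
Import Order.TTheory GRing.Theory Num.Theory.
Import numFieldNormedType.Exports.
Local Open Scope classical_set_scope.
Local Open Scope ring_scope.

(** Regularity at the origin depends only on the differential of the evolutoid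
there, which is computed exactly.  Write k1, k2 for the principal curvatures at
the origin, s and c for the sine and cosine of alpha, and dN for the
differential of f_vv at the origin, so that dN = a12 du + a03 dv when a12 and
a03 denote the derivatives of f_vv along u and v.

At the origin E, F, G and the area density have zero differential, and so does
G_u = 2 f_v f_uv, a product of two functions vanishing there.  The second
fundamental form is diagonal with distinct eigenvalues k2 < k1, so that to first
order its smaller eigenvalue kappa_2 is its second diagonal entry:
d kappa_2 = dN (jet_kappa2).  Hence r = 1 / (s k2) and dr = - dN / (s k2^2),
and the product rule gives the differential of the evolutoid
(is_diff_evolutoid):
  ((1 - k1/k2) du + c dr,  0,  (c k1 / (s k2)) du + s dr).
The middle coordinate vanishes because the motion dv of the foot point is
cancelled by the rotation -k2 dv of the normal multiplied by r s = 1/k2.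

The map has rank 2 exactly when this differential is injective (regular_atP).
If a03 = 0, then dr does not involve dv and the vector of the v-axis lies in the
kernel: the evolutoid is singular.  Conversely, eliminating dr between the two
remaining coordinates of a kernel vector leaves (k1 - k2 s^2) du = 0.  When
k1 <> k2 s^2 this forces du = 0, then dr = 0, then a03 dv = 0; thus the evolutoid
is regular as soon as a03 <> 0 (regular_evolutoid1P).  The genericity condition
is therefore k1 <> k2 s^2, which defines an open dense set of pairs of
curvatures.

The differentials are computed with 1-jets of functions at a point, which
combine like dual numbers under sum, product, inverse and square root. *)

(** * First-order jets of scalar functions *)

Section Differentials.
Context {R : realType} {V W : normedModType R}.

Lemma is_diff_near_eq (p : V) (f g df : V -> W) :
  {near p, f =1 g} -> is_diff p f df -> is_diff p g df.
Proof.
move=> fg [fp <-].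
have [dfc fE] := (diff_locallyP p f).1 fp.
have gE : g \o shift p = cst (g p) + 'd f p +o_ 0 id.
  have fg0 : {near (0 : V), f \o shift p =1 g \o shift p}.
    by have := fg; rewrite -[X in \forall x \near X, _]/(p) (near_shift 0 p) subr0.
  have fgp : f p = g p by exact: (nbhs_singleton fg).
  apply/eqaddoP => e e0.
  have /eqaddoP /(_ e e0) := fE.
  apply: filterS2 fg0 => x; rewrite !fctE /= -fgp => ->.
  exact.
have dg : 'd g p = 'd f p :> (V -> W) by exact: diff_unique dfc gE.
apply: DiffDef; last exact: dg.
by apply/diff_locallyP; rewrite dg.
Qed.

End Differentials.

Section Jets.
Context {R : realType} {V : normedModType R} (p : V).
Implicit Types (f g : V -> R) (d : V -> R).

(** The value is part of the jet because it enters the differentials of products,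
inverses and square roots. *)
Definition has_jet1 f (y : R) d := f p = y /\ is_diff p f d.

(** Jet arithmetic returns unsimplified expressions; this lets a lemma state the
simplified ones and leaves only algebraic identities to check. *)
Lemma jet1_eq f y y' d d' :
  has_jet1 f y d -> y = y' -> d =1 d' -> has_jet1 f y' d'.
Proof. by move=> fj <- /funext <-. Qed.

Lemma jet1_near_eq f g y d :
  {near p, f =1 g} -> has_jet1 f y d -> has_jet1 g y d.
Proof.
move=> fg [<- fj]; split; first by rewrite (nbhs_singleton fg).
exact: is_diff_near_eq fg fj.
Qed.

Lemma jet1_cst (a : R) : has_jet1 (fun=> a) a (fun=> 0).
Proof. by split=> //; exact: is_diff_cst. Qed.

Lemma jet1D f g y z df dg : has_jet1 f y df -> has_jet1 g z dg ->
  has_jet1 (fun x => f x + g x) (y + z) (fun v => df v + dg v).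
Proof. by move=> [<- fd] [<- gd]; split=> //; exact: is_diffD. Qed.

Lemma jet1N f y df : has_jet1 f y df ->
  has_jet1 (fun x => - f x) (- y) (fun v => - df v).
Proof. by move=> [<- fd]; split=> //; exact: is_diffN. Qed.

Lemma jet1M f g y z df dg : has_jet1 f y df -> has_jet1 g z dg ->
  has_jet1 (fun x => f x * g x) (y * z) (fun v => y * dg v + z * df v).
Proof. by move=> [<- fd] [<- gd]; split=> //; exact: is_diffM. Qed.

Lemma jet1_comp f (h : R -> R) y df c : has_jet1 f y df ->
  is_derive y 1 h c -> has_jet1 (fun x => h (f x)) (h y) (fun v => c * df v).
Proof.
move=> [<- fd] [hd hE]; split=> //.
have hdiff : is_diff (f p) h ( *:%R^~ c).
  apply: DiffDef; first exact/derivable1_diffP.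
  by rewrite deriv1E// derive1E hE.
apply: (is_diff_eq (f := h \o f)).
by apply/funext => v /=; rewrite mulrC.
Qed.

Lemma jet1_inv f y df : y != 0 -> has_jet1 f y df ->
  has_jet1 (fun x => (f x)^-1) y^-1 (fun v => - y ^- 2 * df v).
Proof.
move=> y0 [fy [fd fE]]; split; first by rewrite fy.
have fp0 : f p != 0 by rewrite fy.
apply: DiffDef; first exact: differentiableV.
by rewrite diffV// fy fE.
Qed.

Lemma jet1_sqrt f y df : 0 < y -> has_jet1 f y df ->
  has_jet1 (fun x => Num.sqrt (f x)) (Num.sqrt y)
           (fun v => (2 * Num.sqrt y)^-1 * df v).
Proof. by move=> y0 fj; apply: jet1_comp fj _; exact: is_derive1_sqrt. Qed.

End Jets.

(** * Vectors of coordinates and rank of a differential *)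

Section Vectors.
Context {R : realType}.
Implicit Types a b c : R.

Lemma vec3E a b c : (vec3 a b c 0 0 = a) * (vec3 a b c 0 1 = b) *
  (vec3 a b c 0 2 = c).
Proof. by rewrite /vec3 !mxE. Qed.

Lemma row3P (u v : 'rV[R]_3) :
  u 0 0 = v 0 0 -> u 0 1 = v 0 1 -> u 0 2 = v 0 2 -> u = v.
Proof.
move=> e0 e1 e2; apply/rowP => -[[|[|[|]]]//= i3].
- by rewrite (_ : Ordinal i3 = 0)//; exact/val_inj.
- by rewrite (_ : Ordinal i3 = 1)//; exact/val_inj.
- by rewrite (_ : Ordinal i3 = 2)//; exact/val_inj.
Qed.

Lemma row2P (u v : 'rV[R]_2) : u 0 0 = v 0 0 -> u 0 1 = v 0 1 -> u = v.
Proof.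
move=> e0 e1; apply/rowP => -[[|[|]]//= i2].
- by rewrite (_ : Ordinal i2 = 0)//; exact/val_inj.
- by rewrite (_ : Ordinal i2 = 1)//; exact/val_inj.
Qed.

Lemma scale_vec3 t a b c : t *: vec3 a b c = vec3 (t * a) (t * b) (t * c).
Proof. by apply: row3P; rewrite mxE !vec3E. Qed.

Lemma add_vec3 a b c a' b' c' :
  vec3 a b c + vec3 a' b' c' = vec3 (a + a') (b + b') (c + c').
Proof. by apply: row3P; rewrite mxE !vec3E. Qed.

Lemma dot_vec3 a b c a' b' c' :
  dot (vec3 a b c) (vec3 a' b' c') = a * a' + b * b' + c * c'.
Proof. by rewrite /dot 3!big_ord_recl big_ord0 addr0 addrA !mxE. Qed.

Lemma cross_graph a b : cross (vec3 1 0 a) (vec3 0 1 b) = vec3 (- a) (- b) 1.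
Proof. by rewrite /cross !vec3E; congr vec3; ring. Qed.

Lemma is_diff_vec3 {V : normedModType R} (p : V) (F : V -> 'rV[R]_3)
    y0 y1 y2 d0 d1 d2 :
  has_jet1 p (fun x => F x 0 0) y0 d0 ->
  has_jet1 p (fun x => F x 0 1) y1 d1 ->
  has_jet1 p (fun x => F x 0 2) y2 d2 ->
  is_diff p F (fun v => vec3 (d0 v) (d1 v) (d2 v)).
Proof.
move=> [_ [F0 dF0]] [_ [F1 dF1]] [_ [F2 dF2]].
pose G : V -> 'rV[R]_3 := (fun x => F x 0 0 *: delta_mx 0 0) +
  (fun x => F x 0 1 *: delta_mx 0 1) + (fun x => F x 0 2 *: delta_mx 0 2).
have FG : F = G.
  by apply/funext => x; apply: row3P; rewrite /G !fctE !mxE /=; ring.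
have D (k c : 'I_3) : differentiable (fun x => F x 0 k) p ->
    differentiable (fun x => F x 0 k *: (delta_mx 0 c : 'rV[R]_3)) p.
  exact: differentiableZl.
have Fp : differentiable F p.
  by rewrite FG; apply: differentiableD;
    [apply: differentiableD; [exact: D F0|exact: D F1]|exact: D F2].
apply: DiffDef; first exact: Fp.
apply/funext => v; rewrite -(deriveE _ Fp) derive_mx; last exact: diff_derivable.
apply: row3P; rewrite vec3E mxE.
- by rewrite (deriveE _ F0) dF0.
- by rewrite (deriveE _ F1) dF1.
- by rewrite (deriveE _ F2) dF2.
Qed.

(** A 2 x 3 Jacobian matrix has rank 2 exactly when its rows are independent,
i.e. when the differential, acting on row vectors, is injective. *)
Lemma regular_atP (g : 'rV[R]_2 -> 'rV[R]_3) p dg : is_diff p g dg ->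
  regular_at g p <-> forall v, dg v = 0 -> v = 0.
Proof.
move=> [gd gE]; split=> [[_ rk] v dv|dg0].
  have /row_freeP[B JB] : row_free ('J g p) by rewrite /row_free rk.
  by rewrite -[v]mulmx1 -JB mulmxA mul_rV_lin1 gE dv mul0mx.
split=> //; apply/eqP/inj_row_free => v.
by rewrite mul_rV_lin1 gE => /dg0.
Qed.

End Vectors.

(** * Fundamental forms of a Monge patch *)

Section MongePatch.
Context {R : realType} (f : 'rV[R]_2 -> R).

Local Notation fu := (pd 0 f).
Local Notation fv := (pd 1 f).

(** Euclidean norm of the cross product of phi_u and phi_v, the area density of
the graph of f. *)
Definition area (x : 'rV[R]_2) := Num.sqrt (fu x ^+ 2 + fv x ^+ 2 + 1).

Lemma pd_vec3 {i : 'I_2} {a b c : 'rV[R]_2 -> R} {x} :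
  differentiable a x -> differentiable b x -> differentiable c x ->
  pd i (fun x => vec3 (a x) (b x) (c x)) x =
  vec3 (pd i a x) (pd i b x) (pd i c x).
Proof.
move=> ad bd cd; rewrite /pd.
have [D dD] : is_diff x (fun x => vec3 (a x) (b x) (c x)) (fun v =>
    vec3 ('d a x v) ('d b x v) ('d c x v)).
  have e k g : (fun x => vec3 (a x) (b x) (c x) 0 k) = g ->
      differentiable g x ->
      has_jet1 x (fun x => vec3 (a x) (b x) (c x) 0 k) (g x) ('d g x).
    by move=> -> gd; split=> //; exact: differentiableP.
  by apply: is_diff_vec3; apply: e => //; apply/funext => y; rewrite vec3E.
by rewrite (deriveE _ D) dD (deriveE _ ad) (deriveE _ bd) (deriveE _ cd).
Qed.

Lemma pd_near {V : normedModType R} (i : 'I_2) (g h : 'rV[R]_2 -> V) x :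
  {near x, g =1 h} -> pd i g x = pd i h x.
Proof. by move=> gh; exact: near_eq_derive. Qed.

Lemma pd_cst (i : 'I_2) (a : R) x : pd i (fun=> a) x = 0.
Proof. exact: derive_cst. Qed.

Lemma pd_coord (i j : 'I_2) x :
  pd i (fun x : 'rV[R]_2 => x 0 j) x = (i == j)%:R.
Proof.
rewrite /pd -[LHS](_ : ('D_(delta_mx 0 i) id x : 'rV[R]_2) 0 j = _).
  by rewrite derive_id mxE eqxx /= eq_sym.
by rewrite derive_mx ?mxE//; exact: derivable_id.
Qed.

Lemma pd_monge x : differentiable f x ->
  (pd 0 (monge f) x = vec3 1 0 (fu x)) * (pd 1 (monge f) x = vec3 0 1 (fv x)).
Proof.
move=> fd; split; rewrite /monge pd_vec3 ?pd_coord//;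
  exact: differentiable_coord.
Qed.

Lemma unit_normal_monge x : differentiable f x ->
  unit_normal (monge f) x = vec3 (- fu x / area x) (- fv x / area x) (area x)^-1.
Proof.
move=> fd.
have nE : cross (pd 0 (monge f) x) (pd 1 (monge f) x) =
    vec3 (- fu x) (- fv x) 1.
  by rewrite (pd_monge fd).1 (pd_monge fd).2 cross_graph.
rewrite /unit_normal nE /enorm dot_vec3 /area.
move: (fu x) (fv x) => a b; rewrite !mulrNN -!expr2 expr1n scale_vec3.
by congr vec3; ring.
Qed.

Lemma coefE_monge x : differentiable f x ->
  Defs.coefE (monge f) x = 1 + fu x * fu x.
Proof.
move=> fd; rewrite /Defs.coefE !(pd_monge fd) dot_vec3.
by move: (fu x) (fv x) => a b; ring.
Qed.

Lemma coefF_monge x : differentiable f x ->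
  Defs.coefF (monge f) x = fu x * fv x.
Proof.
move=> fd; rewrite /Defs.coefF !(pd_monge fd) dot_vec3.
by move: (fu x) (fv x) => a b; ring.
Qed.

Lemma coefG_monge x : differentiable f x ->
  Defs.coefG (monge f) x = 1 + fv x * fv x.
Proof.
move=> fd; rewrite /Defs.coefG !(pd_monge fd) dot_vec3.
by move: (fu x) (fv x) => a b; ring.
Qed.

(** The inner partial derivative is known only where f is differentiable, hence
differentiability near x, not merely at x, to differentiate once more. *)
Lemma pd2_monge i x : (\forall y \near x, differentiable f y) ->
  (differentiable fu x ->
   pd i (pd 0 (monge f)) x = vec3 0 0 (pd i fu x)) *
  (differentiable fv x ->
   pd i (pd 1 (monge f)) x = vec3 0 0 (pd i fv x)).
Proof.
move=> fd; split=> gd.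
  rewrite (@pd_near _ _ _ (fun y => vec3 1 0 (fu y))); last first.
    by apply: filterS fd => y /pd_monge ->.
  by rewrite pd_vec3 ?pd_cst//; exact: differentiable_cst.
rewrite (@pd_near _ _ _ (fun y => vec3 0 1 (fv y))); last first.
  by apply: filterS fd => y /pd_monge ->.
by rewrite pd_vec3 ?pd_cst//; exact: differentiable_cst.
Qed.

Lemma pd_coefG_monge i x : (\forall y \near x, differentiable f y) ->
  differentiable fv x -> pd i (Defs.coefG (monge f)) x = 2 * fv x * pd i fv x.
Proof.
move=> fd gd; rewrite (@pd_near _ _ _ (fun y => 1 + fv y * fv y)); last first.
  by apply: filterS fd => y /coefG_monge ->.
have fvj : has_jet1 x fv (fv x) ('d fv x) by split=> //; exact: differentiableP.
have [_ [D dE]] := jet1D (jet1_cst x 1) (jet1M fvj fvj).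
have -> : pd i fv x = 'd fv x (delta_mx 0 i) by exact: deriveE.
have -> : pd i (fun y => 1 + fv y * fv y) x =
    'd (fun y => 1 + fv y * fv y) x (delta_mx 0 i) by exact: deriveE.
by rewrite dE; move: (fv x) ('d fv x _) => a b; ring.
Qed.

Lemma second_form_monge x : (\forall y \near x, differentiable f y) ->
  differentiable fu x -> differentiable fv x ->
  [/\ Defs.coefL (monge f) x = pd 0 fu x / area x,
      Defs.coefM (monge f) x = pd 0 fv x / area x &
      Defs.coefN (monge f) x = pd 1 fv x / area x].
Proof.
move=> fd gd hd; have fx := nbhs_singleton fd.
split.
- by rewrite /Defs.coefL (pd2_monge 0 fd).1// unit_normal_monge// dot_vec3
    !(mul0r, add0r).
- by rewrite /Defs.coefM (pd2_monge 0 fd).2// unit_normal_monge// dot_vec3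
    !(mul0r, add0r).
- by rewrite /Defs.coefN (pd2_monge 1 fd).2// unit_normal_monge// dot_vec3
    !(mul0r, add0r).
Qed.

End MongePatch.

(** * Jets at the origin of the fundamental forms *)

Section JetsAtOrigin.
Context {R : realType} (f : 'rV[R]_2 -> R) (k1 k2 : R).
Context (hf : monge_form f k1 k2).

Local Notation fu := (pd 0 f).
Local Notation fv := (pd 1 f).
Local Notation phi := (monge f).
Local Notation jet := (has_jet1 (0 : 'rV[R]_2)).

Lemma near_differentiable_pd :
  \forall x \near 0, forall s, differentiable (foldr (@pd R R) f s) x.
Proof. by have [] := hf. Qed.

Lemma near_differentiable s :
  \forall x \near 0, differentiable (foldr (@pd R R) f s) x.
Proof. by apply: filterS near_differentiable_pd => x; exact. Qed.

Lemma diff_pd_coord g (v : 'rV[R]_2) : differentiable g 0 ->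
  'd g 0 v = v 0 0 * pd 0 g 0 + v 0 1 * pd 1 g 0 :> R.
Proof.
move=> gd; rewrite /pd !(deriveE _ gd).
have {1}-> : v = v 0 0 *: delta_mx 0 0 + v 0 1 *: delta_mx 0 1.
  by apply: row2P; rewrite !mxE /= ?(mulr1, mulr0, addr0, add0r).
by rewrite linearD !linearZ.
Qed.

Lemma jet1_diff g y : differentiable g 0 -> g 0 = y -> jet g y ('d g 0).
Proof. by move=> gd gy; split=> //; exact: differentiableP. Qed.

Lemma pd_diff s : differentiable (foldr (@pd R R) f s) 0.
Proof. exact: (nbhs_singleton (near_differentiable s)). Qed.

Lemma jet_f : jet f 0 (fun=> 0).
Proof.
have [_ f0 fd _] := hf.
apply: (jet1_eq (jet1_diff (pd_diff [::]) f0)) => // v.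
by rewrite diff_pd_coord ?fd ?mulr0 ?addr0//; exact: (pd_diff [::]).
Qed.

Lemma jet_fu : jet fu 0 (fun v => k1 * v 0 0).
Proof.
have [_ _ fd fdd] := hf.
apply: (jet1_eq (jet1_diff (pd_diff [:: 0]) (fd 0))) => // v.
rewrite diff_pd_coord; last exact: (pd_diff [:: 0]).
by rewrite !fdd /= mulr0 addr0 mulrC.
Qed.

Lemma jet_fv : jet fv 0 (fun v => k2 * v 0 1).
Proof.
have [_ _ fd fdd] := hf.
apply: (jet1_eq (jet1_diff (pd_diff [:: 1]) (fd 1))) => // v.
rewrite diff_pd_coord; last exact: (pd_diff [:: 1]).
by rewrite !fdd /= mulr0 add0r mulrC.
Qed.

Local Notation dL := ('d (pd 0 fu) (0 : 'rV[R]_2)).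
Local Notation dM := ('d (pd 0 fv) (0 : 'rV[R]_2)).
Local Notation dN := ('d (pd 1 fv) (0 : 'rV[R]_2)).

Lemma jet_fuu : jet (pd 0 fu) k1 dL.
Proof.
by have [_ _ _ fdd] := hf; apply: jet1_diff; [exact: (pd_diff [:: 0; 0])|
  rewrite fdd].
Qed.

Lemma jet_fuv : jet (pd 0 fv) 0 dM.
Proof.
by have [_ _ _ fdd] := hf; apply: jet1_diff; [exact: (pd_diff [:: 0; 1])|
  rewrite fdd].
Qed.

Lemma jet_fvv : jet (pd 1 fv) k2 dN.
Proof.
by have [_ _ _ fdd] := hf; apply: jet1_diff; [exact: (pd_diff [:: 1; 1])|
  rewrite fdd].
Qed.

Lemma jet_area : jet (area f) 1 (fun=> 0).
Proof.
have J := jet1D (jet1D (jet1M jet_fu jet_fu) (jet1M jet_fv jet_fv))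
  (jet1_cst 0 1).
have {}J : jet (fun x => fu x ^+ 2 + fv x ^+ 2 + 1) 1 (fun=> 0).
  by apply: (jet1_eq J) => [|v]; ring.
apply: (jet1_eq (jet1_sqrt ltr01 J)) => [|v]; first by rewrite sqrtr1.
by rewrite mulr0.
Qed.

Lemma jet_coefE : jet (Defs.coefE phi) 1 (fun=> 0).
Proof.
apply: (@jet1_near_eq _ _ _ (fun x => 1 + fu x * fu x)).
  by apply: filterS (near_differentiable [::]) => x /coefE_monge.
apply: (jet1_eq (jet1D (jet1_cst 0 1) (jet1M jet_fu jet_fu))) => [|v]; ring.
Qed.

Lemma jet_coefF : jet (Defs.coefF phi) 0 (fun=> 0).
Proof.
apply: (@jet1_near_eq _ _ _ (fun x => fu x * fv x)).
  by apply: filterS (near_differentiable [::]) => x /coefF_monge.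
apply: (jet1_eq (jet1M jet_fu jet_fv)) => [|v]; ring.
Qed.

Lemma jet_coefG : jet (Defs.coefG phi) 1 (fun=> 0).
Proof.
apply: (@jet1_near_eq _ _ _ (fun x => 1 + fv x * fv x)).
  by apply: filterS (near_differentiable [::]) => x /coefG_monge.
apply: (jet1_eq (jet1D (jet1_cst 0 1) (jet1M jet_fv jet_fv))) => [|v]; ring.
Qed.

(** G_u = 2 f_v f_uv, where both f_v and f_uv vanish at the origin. *)
Lemma jet_pd_coefG : jet (pd 0 (Defs.coefG phi)) 0 (fun=> 0).
Proof.
apply: (@jet1_near_eq _ _ _ (fun x => 2 * fv x * pd 0 fv x)).
  apply: filterS2 (near_join (near_differentiable [::]))
    (near_differentiable [:: 1]) => x fx fvx.
  by rewrite pd_coefG_monge.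
apply: (jet1_eq (jet1M (jet1M (jet1_cst 0 2) jet_fv) jet_fuv)) => [|v]; ring.
Qed.

Lemma near_second_form : \forall x \near (0 : 'rV[R]_2),
  [/\ Defs.coefL phi x = pd 0 fu x / area f x,
      Defs.coefM phi x = pd 0 fv x / area f x &
      Defs.coefN phi x = pd 1 fv x / area f x].
Proof.
apply: filterS3 (near_join (near_differentiable [::]))
  (near_differentiable [:: 0]) (near_differentiable [:: 1]) => x.
exact: second_form_monge.
Qed.

(** The area density is 1 up to second order, so that the second fundamental form
agrees to first order with the Hessian of f. *)
Lemma jet_div_area g y dg : jet g y dg -> jet (fun x => g x / area f x) y dg.
Proof.
move=> gj; have J := jet1M gj (jet1_inv (oner_neq0 R) jet_area).
by apply: (jet1_eq J) => [|v]; rewrite invr1; ring.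
Qed.

Lemma jet_coefL : jet (Defs.coefL phi) k1 dL.
Proof.
apply: jet1_near_eq (jet_div_area jet_fuu).
by apply: filterS near_second_form => x [].
Qed.

Lemma jet_coefM : jet (Defs.coefM phi) 0 dM.
Proof.
apply: jet1_near_eq (jet_div_area jet_fuv).
by apply: filterS near_second_form => x [].
Qed.

Lemma jet_coefN : jet (Defs.coefN phi) k2 dN.
Proof.
apply: jet1_near_eq (jet_div_area jet_fvv).
by apply: filterS near_second_form => x [].
Qed.

End JetsAtOrigin.

(** * Second principal curvature and differential of the evolutoid *)

Section PrincipalCurvature.
Context {R : realType} (phi : 'rV[R]_2 -> 'rV[R]_3) (p : 'rV[R]_2).
Local Notation jet := (has_jet1 p).
Context (k1 k2 : R) (dL dM dN : 'rV[R]_2 -> R) (k21 : k2 < k1).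
Context (jet_coefE : jet (Defs.coefE phi) 1 (fun=> 0))
  (jet_coefF : jet (Defs.coefF phi) 0 (fun=> 0))
  (jet_coefG : jet (Defs.coefG phi) 1 (fun=> 0))
  (jet_coefL : jet (Defs.coefL phi) k1 dL)
  (jet_coefM : jet (Defs.coefM phi) 0 dM)
  (jet_coefN : jet (Defs.coefN phi) k2 dN).

Lemma jet_metric_det : jet (fun x => Defs.coefE phi x * Defs.coefG phi x -
    Defs.coefF phi x ^+ 2) 1 (fun=> 0).
Proof.
have J := jet1D (jet1M jet_coefE jet_coefG) (jet1N (jet1M jet_coefF jet_coefF)).
by apply: (jet1_eq J) => [|v]; ring.
Qed.

Lemma jet_mean_curvature : jet (mean_curvature phi) ((k1 + k2) / 2)
  (fun v => (dL v + dN v) / 2).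
Proof.
have J := jet1M (jet1D (jet1D (jet1M jet_coefE jet_coefN)
    (jet1N (jet1M (jet1M (jet1_cst p 2) jet_coefF) jet_coefM)))
    (jet1M jet_coefG jet_coefL))
  (jet1_inv _ (jet1M (jet1_cst p 2) jet_metric_det)).
apply: (jet1_eq (J _)) => [||v]; first by rewrite mulr1 pnatr_eq0.
  by field.
by move: (dL v) (dM v) (dN v) => a b c; field.
Qed.

Lemma jet_gauss_curvature : jet (gauss_curvature phi) (k1 * k2)
  (fun v => k1 * dN v + k2 * dL v).
Proof.
have J := jet1M (jet1D (jet1M jet_coefL jet_coefN)
    (jet1N (jet1M jet_coefM jet_coefM)))
  (jet1_inv (oner_neq0 R) jet_metric_det).
apply: (jet1_eq J) => [|v]; first by field.
by move: (dL v) (dM v) (dN v) => a b c; field.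
Qed.

(** First-order perturbation of a simple eigenvalue: the discriminant is the
positive number ((k1 - k2) / 2)^2 at p, where its square root is therefore
differentiable, and the contribution of L cancels between the mean curvature and
that square root. *)
Lemma jet_kappa2 : jet (kappa2 phi) k2 dN.
Proof.
have J := jet1D (jet1M jet_mean_curvature jet_mean_curvature)
  (jet1N jet_gauss_curvature).
have d0 : 0 < (k1 - k2) / 2 by rewrite divr_gt0 ?subr_gt0.
have {}J : jet (fun x => mean_curvature phi x ^+ 2 - gauss_curvature phi x)
    (((k1 - k2) / 2) ^+ 2) (fun v => (k1 - k2) / 2 * (dL v - dN v)).
  apply: (jet1_eq J) => [|v]; first by field.
  by move: (dL v) (dN v) => a c; field.
have S := jet1_sqrt (exprn_gt0 2 d0) J.
apply: (jet1_eq (jet1D jet_mean_curvature (jet1N S))) => [|v].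
  by rewrite sqrtr_sqr gtr0_norm//; field.
rewrite sqrtr_sqr gtr0_norm//; move: (dL v) (dN v) => a c; field.
by rewrite subr_eq0 gt_eqF.
Qed.

End PrincipalCurvature.

(** With dN = d kappa_2, this is the differential of phi + r (cos alpha phi_u +
sin alpha n) at the origin, n being the unit normal.  There d phi = (du, dv, 0),
d phi_u = (0, 0, k1 du), dn = (- k1 du, - k2 dv, 0), r = 1 / (sin alpha k2) and
dr is the differential of r. *)
Definition evolutoid1_diff (R : realType) (k1 k2 alpha : R)
    (dN : 'rV[R]_2 -> R) (v : 'rV[R]_2) : 'rV[R]_3 :=
  let dr := - dN v / (sin alpha * k2 ^+ 2) in
  vec3 (v 0 0 * (1 - k1 / k2) + cos alpha * dr) 0
       (v 0 0 * (cos alpha / sin alpha * k1 / k2) + sin alpha * dr).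

Section EvolutoidDifferential.
Context {R : realType} (f : 'rV[R]_2 -> R) (k1 k2 alpha : R).
Context (hf : monge_form f k1 k2) (k20 : k2 != 0).
Context (sin0 : sin alpha != 0).

Local Notation phi := (monge f).
Local Notation jet := (has_jet1 (0 : 'rV[R]_2)).
Context (dN : 'rV[R]_2 -> R) (jet_k2 : jet (kappa2 phi) k2 dN).

Lemma jet_evolutoid_radius : jet (evolutoid_radius phi alpha)
  (sin alpha * k2)^-1 (fun v => - dN v / (sin alpha * k2 ^+ 2)).
Proof.
have SE := jet1_sqrt ltr01 (jet_coefE hf).
have N := jet1N (jet1M (jet1M (jet1_cst 0 2) SE) (jet_coefG hf)).
have D := jet1D (jet1M (jet1_cst 0 (cos alpha)) (jet_pd_coefG hf))
  (jet1N (jet1M (jet1M (jet1M (jet1_cst 0 (2 * sin alpha)) SE)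
    (jet_coefG hf)) jet_k2)).
have J := jet1M N (jet1_inv _ D).
have D0 : sin alpha * k2 != 0 by rewrite mulf_neq0.
apply: (jet1_eq (J _)) => [||v]; rewrite sqrtr1.
- rewrite !(mulr1, mulr0, add0r) oppr_eq0 -mulrA mulf_neq0 ?pnatr_eq0//.
- by field; rewrite k20 sin0.
- by move: (dN v) => a; field; rewrite k20 sin0.
Qed.

Lemma is_diff_evolutoid :
  is_diff (0 : 'rV[R]_2) (evolutoid1 phi alpha) (evolutoid1_diff k1 k2 alpha dN).
Proof.
(* F spells out the coordinates of the evolutoid by formulas valid only near the
   origin, where f is differentiable. *)
pose F x := let r := evolutoid_radius phi alpha x in
  let t := cos alpha / Num.sqrt (Defs.coefE phi x) in
  vec3 (x 0 0 + r * (t + sin alpha * (- pd 0 f x / area f x)))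
       (x 0 1 + r * (sin alpha * (- pd 1 f x / area f x)))
       (f x + r * (t * pd 0 f x + sin alpha * (area f x)^-1)).
have evE : {near (0 : 'rV[R]_2), F =1 evolutoid1 phi alpha}.
  apply: filterS (near_differentiable hf [::]) => x fx.
  rewrite /evolutoid1 (pd_monge fx).1 unit_normal_monge// !scale_vec3 add_vec3.
  by rewrite scale_vec3 add_vec3 mulr1 mulr0 add0r.
have r := jet_evolutoid_radius.
have SE := jet1_sqrt ltr01 (jet_coefE hf).
have s := jet1_cst (0 : 'rV[R]_2) (sin alpha).
have sq1 : Num.sqrt (1 : R) != 0 by rewrite sqrtr1 oner_neq0.
have t := jet1M (jet1_cst (0 : 'rV[R]_2) (cos alpha)) (jet1_inv sq1 SE).
have A := jet_area hf.
have Ai := jet1_inv (oner_neq0 R) A.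
have xj (j : 'I_2) : jet (fun x => x 0 j) 0 (fun v => v 0 j).
  have xd := differentiable_coord (0 : 'rV[R]_2) 0 j.
  apply: (jet1_eq (jet1_diff xd (mxE _ _ _ _))) => // v.
  rewrite -(deriveE _ xd) -[LHS](_ : ('D_v id (0 : 'rV[R]_2) : 'rV[R]_2) 0 j = _).
    by rewrite derive_id.
  by rewrite derive_mx ?mxE//; exact: derivable_id.
have Xu := jet1M (jet1N (jet_fu hf)) Ai.
have Xv := jet1M (jet1N (jet_fv hf)) Ai.
have c0 := jet1D (xj 0) (jet1M r (jet1D t (jet1M s Xu))).
have c1 := jet1D (xj 1) (jet1M r (jet1M s Xv)).
have c2 := jet1D (jet_f hf) (jet1M r
  (jet1D (jet1M t (jet_fu hf)) (jet1M s Ai))).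
apply: is_diff_near_eq evE _.
apply: (is_diff_eq (f' := _)).
  apply: is_diff_vec3.
  - by apply: (jet1_near_eq _ c0); near=> x; rewrite /F vec3E.
  - by apply: (jet1_near_eq _ c1); near=> x; rewrite /F vec3E.
  - by apply: (jet1_near_eq _ c2); near=> x; rewrite /F vec3E.
apply/funext => v; rewrite /evolutoid1_diff; move: (v 0 0) (v 0 1) (dN v) => a b c.
rewrite sqrtr1; congr vec3; field; by rewrite k20 sin0.
Unshelve. all: by end_near. Qed.

End EvolutoidDifferential.

(** * Genericity and the regularity criterion *)

Section Genericity.
Context {R : realType}.

(** With s the square of sin alpha, the factor k1 - k2 s is what the elimination
in regular_evolutoid1P has to divide by. *)
Definition generic_curvatures (s : R) : set (R * R) :=
  [set k | k.1 - k.2 * s != 0].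

Lemma open_generic_curvatures s : open (generic_curvatures s).
Proof.
apply: (@open_comp _ _ (fun k : R * R => k.1 - k.2 * s) [set x | x != 0]).
  move=> k _; apply: continuousB; first exact: cvg_fst.
  by apply: continuousM; [exact: cvg_snd|exact: cvg_cst].
exact: open_neq.
Qed.

Lemma dense_generic_curvatures s k : closure (generic_curvatures s) k.
Proof.
have [k0|k0] := eqVneq (k.1 - k.2 * s) 0; last exact: subset_closure.
move=> B /nbhs_ballP[e /= e0 eB]; exists (k.1 + e / 2, k.2); split.
  rewrite /generic_curvatures /= addrAC k0 add0r mulf_neq0//.
  exact: lt0r_neq0.
apply: eB; split => /=; last exact: ballxx.
rewrite /ball /= opprD addNKr normrN gtr0_norm ?divr_gt0//.
by rewrite ltr_pdivrMr// ltr_pMr// ltr1n.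
Qed.

End Genericity.

(** The differential of f_vv sends the vector of the v-axis to a03, which ties
the kernel of the differential of the evolutoid to the ridge condition. *)
Lemma regular_evolutoid1P (R : realType) (f : 'rV[R]_2 -> R) (k1 k2 alpha : R) :
  monge_form f k1 k2 -> k2 < k1 -> k2 != 0 -> sin alpha != 0 ->
  k1 - k2 * sin alpha ^+ 2 != 0 ->
  regular_at (evolutoid1 (monge f) alpha) 0 <-> ~ ridge_origin_dv f.
Proof.
move=> hf k21 k20 s0 gen.
have k2j := jet_kappa2 k21 (jet_coefE hf) (jet_coefF hf) (jet_coefG hf)
  (jet_coefL hf) (jet_coefM hf) (jet_coefN hf).
have fvvd := pd_diff hf [:: 1; 1].
have dE := is_diff_evolutoid hf k20 s0 k2j.
apply: (iff_trans (regular_atP dE)).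
have dN1 : 'd (pd 1 (pd 1 f)) 0 (delta_mx 0 1 : 'rV[R]_2) = taylor_coef f 0 3.
  by rewrite -deriveE.
split=> [inj a03|a03 v].
  have /inj /rowP /(_ 1) :
      evolutoid1_diff k1 k2 alpha ('d (pd 1 (pd 1 f)) 0) (delta_mx 0 1) = 0.
    rewrite /evolutoid1_diff dN1 a03 oppr0 mul0r !mulr0 !mxE /= !mul0r !addr0.
    by apply: row3P; rewrite vec3E mxE.
  by rewrite !mxE /= => /eqP; rewrite oner_eq0.
have vE := diff_pd_coord v fvvd.
have pdE : pd 1 (pd 1 (pd 1 f)) 0 = taylor_coef f 0 3 by [].
rewrite /evolutoid1_diff vE pdE.
move: (pd 0 _ 0) a03; rewrite /ridge_origin_dv.
move: (taylor_coef f 0 3) => b a /eqP b0 /rowP ev.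
have := ev 0; have := ev 2; rewrite !vec3E !mxE.
set r := - _ / _ => h2 h0.
have v0 : v 0 0 = 0.
  have : v 0 0 * (k1 - k2 * sin alpha ^+ 2) = 0.
    (* Coefficients chosen so that the terms in r cancel. *)
    transitivity (k2 * sin alpha * (cos alpha *
      (v 0 0 * (cos alpha / sin alpha * k1 / k2) + sin alpha * r) -
      sin alpha * (v 0 0 * (1 - k1 / k2) + cos alpha * r))).
      have c2 : cos alpha ^+ 2 = 1 - sin alpha ^+ 2.
        by rewrite -(cos2Dsin2 alpha) addrK.
      by field : c2; rewrite k20.
    by rewrite h2 h0; ring.
  by move=> /eqP; rewrite mulf_eq0 (negPf gen) orbF => /eqP.
move: h2; rewrite /r v0 !mul0r !add0r => /eqP.
rewrite !(mulf_eq0, invr_eq0, oppr_eq0, expf_eq0) /=.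
rewrite (negPf s0) (negPf k20) (negPf b0) /= !orbF => /eqP v1.
by apply: row2P; rewrite mxE.
Qed.

Theorem proposition3p5 (R : realType) (alpha : R)
    (halpha0 : 0 < alpha) (halpha1 : alpha < pi / 2) :
  generically (fun f : 'rV[R]_2 -> R =>
    regular_at (evolutoid1 (monge f) alpha) 0 <-> ~ ridge_origin_dv f).
Proof.
have s0 : sin alpha != 0.
  by apply/lt0r_neq0/sin_gt0_pihalf; rewrite halpha0 halpha1.
exists (generic_curvatures (sin alpha ^+ 2)); split.
- exact: open_generic_curvatures.
- by move=> k _; exact: dense_generic_curvatures.
- move=> f k1 k2 hf [/= k21 k120] gen.
  apply: regular_evolutoid1P hf k21 _ s0 gen.
  by apply: contraNneq k120 => ->; rewrite mulr0.
Qed.
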